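(* Let $d\ge 3$ and $0\le j\le \left\lfloor \frac{3(d-1)}{2}\right\rfloor$. The $S_3$-invariant elements of $\operatorname{Ker}(E)\cap A(d)_j$ are exactly the elements $P=\sum_{\lambda\in\mathscr{P}_{3,d-1}(j)}\alpha_\lambda[x^\lambda]$ ($\alpha_\lambda\in\Bbbk$) with $E(P)=0$, and the multiplicity of the trivial representation in $\operatorname{Ker}(E)\cap A(d)_j$ is $$\operatorname{triv}(d,j)=p_{3,d-1}(j)-p_{3,d-1}(j-1).$$
   Context: $\Bbbk$ is an algebraically closed field of characteristic $0$. For an integer $d\ge 1$, $A(d)=\Bbbk[x_1,x_2,x_3]/(x_1^d,x_2^d,x_3^d)=\bigoplus_j A(d)_j$ with its standard grading ($A(d)_j=0$ for $j<0$). The symmetric group $S_3$ acts on $A(d)$ by permuting the variables. The linear map $E:A(d)_{j+1}\to A(d)_j$ is defined on the monomial basis by $E(x_1^{a_1}x_2^{a_2}x_3^{a_3})=\sum_{k=1}^{3} a_k(d-a_k)\,x_1^{a_1}\cdots x_k^{a_k-1}\cdots x_3^{a_3}$; it commutes with the $S_3$-action, so $\operatorname{Ker}(E)\cap A(d)_j$ is an $S_3$-module. $\operatorname{triv}(d,j)$ denotes the multiplicity of the trivial representation in $\operatorname{Ker}(E)\cap A(d)_j$. For integers $l\ge0$, $n$: $\mathscr{P}_{3,l}(n)$ is the set of integer triples $(a,b,c)$ with $l\ge a\ge b\ge c\ge 0$, $a+b+c=n$, and $p_{3,l}(n)=|\mathscr{P}_{3,l}(n)|$ ($=0$ for $n<0$).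 For $\lambda=(a,b,c)$, $[x^\lambda]$ denotes the sum of the distinct monomials in the $S_3$-orbit of $x_1^ax_2^bx_3^c$. *)

(* Defs.v *)
From HB Require Import structures.
From mathcomp Require Import all_boot all_order fingroup perm all_algebra.
Set Implicit Arguments. Unset Strict Implicit. Unset Printing Implicit Defensive.
Import Order.TTheory GRing.Theory Num.Theory.
Local Open Scope ring_scope.

(* Exponent vectors of monomials x_1^{a_1} x_2^{a_2} x_3^{a_3} of A(d) = k[x1,x2,x3]/(x_i^d):
   a : 'I_3 -> 'I_d  (indices 0,1,2 stand for x_1,x_2,x_3). *)
Definition mon (d : nat) := {ffun 'I_3 -> 'I_d}.

Definition mdeg (d : nat) (a : mon d) : nat := (\sum_(i < 3) (a i : nat))%N.

Section A.
Variable (K : fieldType) (d : nat).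

(* Elements of A(d): coefficient functions on the monomial basis
   (K^o: K viewed as a vector space over itself). *)
Definition Ad := {ffun mon d -> K^o}.

Definition mono (a : mon d) : Ad := [ffun b => (b == a)%:R].

Definition Acomp (j : nat) : {vspace Ad} :=
  <<[seq mono a | a <- enum (mon d) & mdeg a == j]>>%VS.

(* exponent vector a with a_k decreased by one (only used when a_k > 0) *)
Definition decr (a : mon d) (k : 'I_3) : mon d :=
  [ffun i => if i == k then Ordinal (leq_ltn_trans (leq_pred (a i)) (ltn_ord (a i)))
             else a i].

Definition Emono (a : mon d) : Ad :=
  \sum_(k < 3) (if (0 < a k)%N then ((a k) * (d - a k))%:R *: mono (decr a k) else 0).

Definition Emap (P : Ad) : Ad := \sum_(a : mon d) P a *: Emono a.

(* S_3 acting by permuting the variables: sigma . x^a = x^{a o sigma^-1},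
   i.e. (sigma . P)(b) = P(b o sigma). *)
Definition act (s : 'S_3) (P : Ad) : Ad := [ffun b : mon d => P [ffun i => b (s i)]].

Definition kerEcomp (j : nat) : {vspace Ad} :=
  (Acomp j :&: lker (linfun Emap))%VS.

Definition invKerE (j : nat) : {vspace Ad} :=
  (kerEcomp j :&: \bigcap_(s : 'S_3) fixedSpace (linfun (act s)))%VS.

(* triv(d,j): multiplicity of the trivial representation in Ker(E) ∩ A(d)_j,
   i.e. dim Hom_{S_3}(triv, Ker(E) ∩ A(d)_j) = dim of the S_3-invariants. *)
Definition triv (j : nat) : nat := \dim (invKerE j).

Definition trip (t : nat * nat * nat) (i : 'I_3) : nat :=
  match val i with 0 => t.1.1 | 1 => t.1.2 | _ => t.2 end.

Definition orbset (t : nat * nat * nat) : {set mon d} :=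
  [set m : mon d | [exists s : 'S_3, [forall i, (m (s i) : nat) == trip t i]]].

Definition orbsum (t : nat * nat * nat) : Ad := \sum_(m in orbset t) mono m.

End A.

(* P_{3,l}(n): triples l >= a >= b >= c >= 0 with a+b+c = n (n : int, so empty for n<0) *)
Definition Pset (l : nat) (n : int) : seq (nat * nat * nat) :=
  [seq t <- [seq (ab.1, ab.2, c) | ab <- [seq (a, b) | a <- iota 0 l.+1, b <- iota 0 l.+1],
                          c <- iota 0 l.+1]
   | (t.2 <= t.1.2 <= t.1.1)%N && (((t.1.1 + t.1.2 + t.2)%N)%:Z == n)].

Definition p3 (l : nat) (n : int) : nat := size (Pset l n).

(* Main.v *)
(* Let F be multiplication by x_1 + x_2 + x_3. On A(d)_j the commutator
   EF - FE is the scalar 3(d-1) - 2j, which is positive below the middle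
   degree. An induction on j shows that FE + c is injective on A(d)_j for every
   c > 0, so EF = FE + (3(d-1) - 2j) is injective on A(d)_j. As E and F commute
   with S_3, EF is then bijective on the invariants of degree j, and E maps the
   invariants of degree j+1 onto those of degree j. The count follows by
   rank-nullity, the orbit sums being a basis of the invariants. *)
Require Import Defs.
From HB Require Import structures.
From mathcomp Require Import all_boot all_order fingroup perm all_algebra.
From mathcomp Require Import zify.
Import Order.TTheory GRing.Theory Num.Theory.
Local Open Scope ring_scope.

(** * Homogeneous components as vanishing conditions on coefficients *)

Lemma AcompP (K : fieldType) (d j : nat) (P : Ad K d) :
  reflect (forall b, mdeg b != j -> P b = 0) (P \in Acomp K d j).
Proof.
apply: (iffP idP) => [PA b bj|P0].
  rewrite /Acomp in PA; rewrite (coord_span (X := in_tuple _) PA).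
  rewrite sum_ffunE big1 // => i _.
  rewrite ffunE [X in _ *: X](_ : _ = 0) ?scaler0 //.
  have /mapP[a] := mem_nth 0 (ltn_ord i).
  rewrite mem_filter => /andP[/eqP aj _] /= ->; rewrite ffunE.
  by case: eqP => // eba; rewrite eba aj eqxx in bj.
rewrite [P](_ : _ = \sum_a P a *: mono K a); last first.
  apply/ffunP => b; rewrite sum_ffunE (bigD1 b) //= !ffunE eqxx big1 => [|a ab].
    by rewrite addr0; exact/esym/mulr1.
  by rewrite !ffunE eq_sym (negPf ab) scaler0.
apply: memv_suml => a _; have [aj|aj] := eqVneq (mdeg a) j.
  apply/memvZ/memv_span/mapP; exists a => //.
  by rewrite mem_filter aj eqxx mem_enum.
by rewrite P0 // scale0r mem0v.
Qed.

(** * Raising and lowering exponents, and the operators E and F *)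

Section Operators.
Variables (K : fieldType) (d : nat).
Implicit Types (P : Ad K d) (a b : mon d) (k l : 'I_3).

(** For [a k = d - 1] the default of [insubd] leaves [a] unchanged. In the formulas for E this
    spurious value is always multiplied by [wt d = 0]. *)
Definition incr a k : mon d :=
  [ffun i => if i == k then insubd (a i) (a i).+1 else a i].

Definition wt (n : nat) : K := (n * (d - n))%:R.

Lemma val_decr a k i : decr a k i = (if i == k then (a i).-1 else a i) :> nat.
Proof. by rewrite ffunE; case: eqP. Qed.

Lemma val_incr a k i :
  incr a k i = (if (i == k) && ((a i).+1 < d)%N then (a i).+1 else a i) :> nat.
Proof. by rewrite ffunE; case: eqP => //= _; rewrite val_insubd. Qed.

Lemma decr_incr a k : ((a k).+1 < d)%N -> decr (incr a k) k = a.
Proof.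
move=> ak; apply/ffunP => i; apply/val_inj; rewrite /= val_decr val_incr.
by case: eqP => //= ->; rewrite ak.
Qed.

Lemma incr_decr a k : (0 < a k)%N -> incr (decr a k) k = a.
Proof.
move=> ak; apply/ffunP => i; apply/val_inj; rewrite /= val_incr val_decr.
by case: eqP => //= ->; rewrite prednK // ltn_ord.
Qed.

Lemma decr_incrC a k l : k != l -> decr (incr a k) l = incr (decr a l) k.
Proof.
move=> kl; apply/ffunP => i; apply/val_inj.
rewrite /= val_decr !val_incr !val_decr.
by case: (eqVneq i l) => // ->; rewrite eq_sym (negPf kl).
Qed.

Lemma mdeg_incr a k : ((a k).+1 < d)%N -> mdeg (incr a k) = (mdeg a).+1.
Proof.
move=> ak; rewrite /mdeg (bigD1 k) //= [in RHS](bigD1 k) //= val_incr eqxx ak.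
rewrite addSn; congr (_ + _).+1; apply: eq_bigr => i /negPf ik.
by rewrite val_incr ik.
Qed.

Lemma mdeg_decr a k : (0 < a k)%N -> (mdeg (decr a k)).+1 = mdeg a.
Proof.
move=> ak; rewrite -{2}(incr_decr _ _ ak) mdeg_incr // val_decr eqxx prednK //.
Qed.

Lemma wt_ge n : (d <= n)%N -> wt n = 0.
Proof. by rewrite /wt -subn_eq0 => /eqP ->; rewrite muln0. Qed.

(** Transpose of the definition: [x^b] arises in [E(x^a)] only from some [k] with [a = incr b k]. If
    [b k = d - 1] no such monomial exists, and the weight vanishes too. *)
Lemma EmapE P b : Emap P b = \sum_k wt (b k).+1 * P (incr b k).
Proof.
rewrite sum_ffunE.
have E1 a : (P a *: Emono K a) b =
    \sum_k (if (0 < a k)%N && (b == decr a k) then wt (a k) * P a else 0).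
  rewrite ffunE sum_ffunE scaler_sumr; apply: eq_bigr => k _.
  case: ifP => /= ak; last by rewrite ffunE scaler0.
  rewrite !ffunE; case: eqP => _; last by rewrite !scaler0.
  by rewrite [LHS]mulrC; congr (_ * _); exact: mulr1.
rewrite (eq_bigr _ (fun a _ => E1 a)) exchange_big; apply: eq_bigr => k _ /=.
have [bk|bk] := ltnP (b k).+1 d; last first.
  rewrite wt_ge // mul0r big1 // => a _; case: ifP => // /andP[ak /eqP eb].
  by move: bk; rewrite eb val_decr eqxx prednK // leqNgt ltn_ord.
rewrite (bigD1 (incr b k)) //= val_incr eqxx bk /= decr_incr // eqxx.
rewrite big1 ?addr0 // => a ab; case: ifP => // /andP[ak /eqP eb].
by rewrite eb incr_decr ?eqxx in ab.
Qed.

(* Multiplication by [x_1 + x_2 + x_3], which together with [Emap] spans an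
   action of sl_2. *)
Definition Fmap P : Ad K d :=
  [ffun b : mon d => \sum_k if (0 < b k)%N then P (decr b k) else 0].

Lemma Emap_is_linear : linear (@Emap K d).
Proof.
move=> c P Q; rewrite /Emap scaler_sumr -big_split; apply: eq_bigr => a _ /=.
by rewrite !ffunE scalerDl scalerA.
Qed.
HB.instance Definition _ :=
  GRing.isLinear.Build K (Ad K d) (Ad K d) *:%R (@Emap K d) Emap_is_linear.

Lemma Fmap_is_linear : linear Fmap.
Proof.
move=> c P Q; apply/ffunP => b; rewrite !ffunE scaler_sumr -big_split.
by apply: eq_bigr => k _ /=; case: ifP; rewrite ?ffunE ?scaler0 ?addr0.
Qed.
HB.instance Definition _ :=
  GRing.isLinear.Build K (Ad K d) (Ad K d) *:%R Fmap Fmap_is_linear.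

Lemma act_is_linear s : linear (@act K d s).
Proof. by move=> c P Q; apply/ffunP => b; rewrite !ffunE. Qed.
HB.instance Definition _ s :=
  GRing.isLinear.Build K (Ad K d) (Ad K d) *:%R (@act K d s) (act_is_linear s).

(** The commutator of E and F, with negative terms moved across so that no truncated subtraction
    occurs. Raising at [k] and lowering at [l] commute for [k != l], so the mixed terms [T] cancel
    and only the diagonal ones remain. *)
Lemma Emap_Fmap P b :
  Emap (Fmap P) b + (2 * mdeg b)%:R * P b =
  Fmap (Emap P) b + (3 * (d - 1))%:R * P b.
Proof.
pose T k l : K :=
  if (0 < b l)%N then wt (b k).+1 * P (incr (decr b l) k) else 0.
have EF : Emap (Fmap P) b =
    \sum_k (wt (b k).+1 * P b + \sum_(l | l != k) T k l).
  rewrite EmapE; apply: eq_bigr => k _; rewrite ffunE (bigD1 k) //= mulrDr.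
  congr (_ + _).
    have [bk|bk] := ltnP (b k).+1 d; last by rewrite wt_ge // !mul0r.
    by rewrite val_incr eqxx bk /= decr_incr.
  rewrite mulr_sumr; apply: eq_bigr => l lk.
  rewrite val_incr (negPf lk) /T /=; case: ifP; rewrite ?mulr0 // => _.
  by rewrite decr_incrC // eq_sym.
have FE : Fmap (Emap P) b =
    \sum_l (wt (b l) * P b + \sum_(k | k != l) T k l).
  rewrite ffunE; apply: eq_bigr => l _; rewrite /T; case: ifP => bl; last first.
    by rewrite big1 // addr0 /wt; case: (nat_of_ord _) bl => //; rewrite mul0r.
  rewrite EmapE (bigD1 l) //= incr_decr // val_decr eqxx prednK //.
  congr (_ + _); apply: eq_bigr => k /negPf kl.
  by rewrite val_decr kl.
rewrite EF FE !big_split /=.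
have -> : \sum_i \sum_(l | l != i) T i l = \sum_i \sum_(l | l != i) T l i.
  rewrite (exchange_big_dep predT) //=; apply: eq_bigr => l _.
  by apply: eq_bigl => k; rewrite eq_sym.
rewrite addrAC [RHS]addrAC; congr (_ + _); rewrite -!mulr_suml -!mulrDl.
congr (_ * _); rewrite /wt -!natr_sum -!natrD /mdeg; congr _%:R.
rewrite !big_ord_recl !big_ord0 /=.
set x := nat_of_ord _; set y := nat_of_ord _; set z := nat_of_ord _.
(* The commutator in one variable: on [x^u] in [K[x]/(x^d)] it acts by [d - 1 - 2 * u]. The three
   variables add up. *)
have step u : (u < d -> u.+1 * (d - u.+1) + 2 * u = u * (d - u) + (d - 1))%N.
  by move=> ud; nia.
have := step _ (ltn_ord (b ord0)); have := step _ (ltn_ord (b (lift ord0 ord0))).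
have := step _ (ltn_ord (b (lift ord0 (lift ord0 ord0)))).
by rewrite -/x -/y -/z; lia.
Qed.

(** * Compatibility of E and F with the grading and with the action of S_3 *)

Lemma Emap_Acomp j P : P \in Acomp K d j.+1 -> Emap P \in Acomp K d j.
Proof.
move/AcompP => PA; apply/AcompP => b bj; rewrite EmapE big1 // => k _.
have [bk|bk] := ltnP (b k).+1 d; last by rewrite wt_ge // mul0r.
by rewrite PA ?mulr0 // mdeg_incr.
Qed.

Lemma Emap_Acomp0 P : P \in Acomp K d 0 -> Emap P = 0.
Proof.
move/AcompP => PA; apply/ffunP => b; rewrite EmapE ffunE big1 // => k _.
have [bk|bk] := ltnP (b k).+1 d; last by rewrite wt_ge // mul0r.
by rewrite PA ?mulr0 // mdeg_incr.
Qed.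

Lemma Fmap_Acomp j P : P \in Acomp K d j -> Fmap P \in Acomp K d j.+1.
Proof.
move/AcompP => PA; apply/AcompP => b bj; rewrite ffunE big1 // => k _.
by case: ifP => // bk; rewrite PA // -eqSS mdeg_decr.
Qed.

Lemma act_Emap s P : act s (Emap P) = Emap (act s P).
Proof.
apply/ffunP => b; rewrite ffunE !EmapE [RHS](reindex_inj (@perm_inj _ s)).
apply: eq_bigr => k _; rewrite !ffunE; congr (_ * P _).
apply/ffunP => i; apply/val_inj.
by rewrite /= [in RHS]ffunE !val_incr !ffunE (inj_eq perm_inj).
Qed.

Lemma act_Fmap s P : act s (Fmap P) = Fmap (act s P).
Proof.
apply/ffunP => b; rewrite !ffunE [RHS](reindex_inj (@perm_inj _ s)).
apply: eq_bigr => k _; rewrite !ffunE; case: ifP => // _; congr (P _).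
apply/ffunP => i; apply/val_inj.
by rewrite /= [in RHS]ffunE !val_decr !ffunE (inj_eq perm_inj).
Qed.

(** All invariants of degree [j], not only those killed by E: rank-nullity is applied to E on this
    space. *)
Definition invA j : {vspace Ad K d} :=
  (Acomp K d j :&: \bigcap_(s : 'S_3) fixedSpace (linfun (@act K d s)))%VS.

Lemma invAP j P :
  reflect (P \in Acomp K d j /\ forall s, act s P = P) (P \in invA j).
Proof.
rewrite memv_cap; apply: (iffP andP) => -[PA Pinv]; split=> //.
  move=> s; move: Pinv; rewrite memvE => /subv_bigcapP/(_ s isT).
  by rewrite -memvE => /fixedSpaceP; rewrite lfunE.
rewrite memvE; apply/subv_bigcapP => s _; rewrite -memvE.
by apply/fixedSpaceP; rewrite lfunE; exact: Pinv.
Qed.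

Lemma Emap_invA j P : P \in invA j.+1 -> Emap P \in invA j.
Proof.
case/invAP => PA Ps; apply/invAP; split; first exact: Emap_Acomp.
by move=> s; rewrite act_Emap Ps.
Qed.

Lemma Fmap_invA j P : P \in invA j -> Fmap P \in invA j.+1.
Proof.
case/invAP => PA Ps; apply/invAP; split; first exact: Fmap_Acomp.
by move=> s; rewrite act_Fmap Ps.
Qed.

(** * Injectivity of EF and surjectivity of E below the middle degree *)

Section CharZero.
Hypothesis charK0 : [pchar K] =i pred0.

Lemma Emap_Fmap_Acomp j P : (2 * j <= 3 * (d - 1))%N -> P \in Acomp K d j ->
  Emap (Fmap P) = Fmap (Emap P) + (3 * (d - 1) - 2 * j)%:R *: P.
Proof.
move=> jd /AcompP PA; apply/ffunP => b; have e := Emap_Fmap P b.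
rewrite [RHS]ffunE [X in _ + X]ffunE; move: e.
have [->|bj] := eqVneq (mdeg b) j; last by rewrite PA // !mulr0 scaler0 !addr0.
by rewrite natrB // => e; rewrite [_ *: _]mulrBl addrA -e addrK.
Qed.

(** Characteristic zero enters here: a positive integer is nonzero in [K]. *)
Lemma natr_scaler_eq0 c P : (0 < c)%N -> c%:R *: P = 0 -> P = 0.
Proof.
by move=> c0 /eqP; rewrite scaler_eq0 ((pcharf0P K).1 charK0) eqn0Ngt c0 => /eqP.
Qed.

(* If [FE P = - c P] then [Q = E P], one degree lower, satisfies
   [FE Q = - (c + m) Q] where [m] is the weight of that degree, so that [c]
   stays positive and induction applies. *)
Lemma FE_addc_inj c j P : (0 < c)%N -> (2 * j <= (3 * (d - 1)).+2)%N ->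
  P \in Acomp K d j -> Fmap (Emap P) + c%:R *: P = 0 -> P = 0.
Proof.
elim: j c P => [|j IH] c P c0 jd PA.
  by rewrite Emap_Acomp0 // linear0 add0r; exact: natr_scaler_eq0.
move=> e; have EPA := Emap_Acomp _ _ PA.
have EP0 : Emap P = 0.
  (* The slack of two in the bound on [j.+1] gives [2 * j <= 3 * (d - 1)], as the commutator formula
     requires in degree [j]. *)
  apply: (IH (3 * (d - 1) - 2 * j + c)%N) => //; [lia|lia|].
  rewrite natrD scalerDl addrA -Emap_Fmap_Acomp //; last lia.
  by rewrite -linearZ -linearD e linear0.
by move: e; rewrite EP0 linear0 add0r; exact: natr_scaler_eq0.
Qed.

(** EF maps the invariants of degree [j] injectively into E of those of degree [j.+1], which gives
    the missing dimension inequality. The strict bound makes the scalar [c] in [FE_addc_inj]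
    positive. *)
Lemma Emap_invA_surj j : (2 * j < 3 * (d - 1))%N ->
  (linfun (@Emap K d) @: invA j.+1)%VS = invA j.
Proof.
move=> jd; apply/eqP; rewrite eqEdim; apply/andP; split.
  apply/subvP => _ /memv_imgP[P PA ->]; rewrite lfunE; exact: Emap_invA.
pose f := (linfun (@Emap K d) \o linfun Fmap)%VF.
have /limg_dim_eq <- : (invA j :&: lker f)%VS = 0%VS.
  apply/eqP; rewrite -subv0; apply/subvP => P; rewrite memv_cap memv_ker memv0.
  case/andP => /invAP[PA _]; rewrite lfunE /= !lfunE /= => /eqP P0; apply/eqP.
  apply: (FE_addc_inj (3 * (d - 1) - 2 * j) j) => //; [lia|lia|].
  by rewrite -Emap_Fmap_Acomp // ltnW.
rewrite limg_comp; apply/dimvS/limgS/subvP => _ /memv_imgP[P PA ->].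
by rewrite lfunE; exact: Fmap_invA.
Qed.

End CharZero.
End Operators.

(** * Orbits of monomials and their decreasing representatives *)

Section OrbitSums.
Variables (K : fieldType) (d : nat).
Hypothesis d_gt0 : (0 < d)%N.
Implicit Types (P : Ad K d) (b : mon d) (t : nat * nat * nat) (j : nat).

Definition triptuple t : 3.-tuple nat := [tuple t.1.1; t.1.2; t.2].

Lemma tnth_triptuple t i : tnth (triptuple t) i = trip t i.
Proof. by rewrite (tnth_nth 0%N); case: i => [[|[|[|]]]]. Qed.

Definition expts b : 3.-tuple nat := [tuple b i : nat | i < 3].

Lemma orbsetP b t : reflect (exists s : 'S_3, forall i, b (s i) = trip t i :> nat)
  (b \in orbset d t).
Proof.
rewrite inE; apply: (iffP existsP) => -[s bs]; exists s.
  by move=> i; move/forallP: bs => /(_ i)/eqP.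
by apply/forallP => i; apply/eqP.
Qed.

(** Replaces the search for a permutation by equality of multisets, so that sorting picks out the
    representative of an orbit. *)
Lemma orbset_perm_eq b t : (b \in orbset d t) = perm_eq (triptuple t) (expts b).
Proof.
apply/orbsetP/tuple_permP => -[s bs]; exists s.
  congr tval; apply: eq_from_tnth => i.
  by rewrite tnth_triptuple !tnth_mktuple bs.
move=> i; rewrite -tnth_triptuple.
have -> : triptuple t = [tuple tnth (expts b) (s i) | i < 3] by apply: val_inj.
by rewrite !tnth_mktuple.
Qed.

Lemma sum_expts b : sumn (expts b) = mdeg b.
Proof. by rewrite sumnE big_tuple; apply: eq_bigr => i _; rewrite tnth_mktuple. Qed.

Lemma mem_Pset t j : (t \in Pset (d - 1) j) =
  [&& (t.1.1 < d)%N, sorted geq (triptuple t) & sumn (triptuple t) == j].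
Proof.
case: t => [[x y] z]; rewrite mem_filter /= andbT addn0 addnA.
have -> : ((x + y + z)%N%:Z == j :> int) = (x + y + z == j)%N by [].
have -> : ((x, y, z) \in [seq (ab.1, ab.2, c)
     | ab <- [seq (p, q) | p <- iota 0 (d - 1).+1, q <- iota 0 (d - 1).+1],
       c <- iota 0 (d - 1).+1]) = [&& x < d, y < d & z < d]%N.
  have mem_l u : (u \in iota 0 (d - 1).+1) = (u < d)%N by rewrite mem_iota; lia.
  move: (iota 0 _) mem_l => l mem_l; apply/allpairsP/and3P.
    case => -[[a1 b1] c1] /= [/allpairsP[[a2 b2] /= [a2d b2d [-> ->]]] c1d].
    by case=> -> -> ->; rewrite -!mem_l.
  case=> xd yd zd; exists ((x, y), z); split; rewrite /= ?mem_l //.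
  by apply/allpairsP; exists (x, y); split; rewrite /= ?mem_l.
lia.
Qed.

Lemma Pset_uniq (n : int) : uniq (Pset (d - 1) n).
Proof.
apply: filter_uniq; apply: allpairs_uniq; rewrite ?iota_uniq //.
  by apply: allpairs_uniq; rewrite ?iota_uniq // => -[? ?] [? ?].
by move=> [[? ?] ?] [[? ?] ?] _ _ /= [-> -> ->].
Qed.

Lemma geq_trans : transitive geq.
Proof. by move=> x y z /= yx xz; apply: leq_trans xz yx. Qed.

Lemma geq_anti : antisymmetric geq.
Proof. by move=> x y /=; rewrite andbC => /anti_leq. Qed.

Lemma orbset_inj b t t' j : t \in Pset (d - 1) j -> t' \in Pset (d - 1) j ->
  b \in orbset d t -> b \in orbset d t' -> t = t'.
Proof.
rewrite !mem_Pset !orbset_perm_eq => /and3P[_ st _] /and3P[_ st' _] bt bt'.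
have : perm_eq (triptuple t) (triptuple t').
  by rewrite (perm_trans bt) // perm_sym.
move=> /(sorted_eq geq_trans geq_anti st st') [].
by case: t {st bt} => [[? ?] ?]; case: t' {st' bt'} => [[? ?] ?] /= -> -> ->.
Qed.

(** Sorting the exponents in decreasing order gives the triple; with [orbset_inj], the orbits
    partition the monomials. *)
Lemma orbset_cover b : exists2 t, t \in Pset (d - 1) (mdeg b) & b \in orbset d t.
Proof.
have pe : perm_eq (sort geq (expts b)) (expts b) by rewrite perm_sort.
have sz : size (sort geq (expts b)) = 3 by rewrite size_sort size_tuple.
have so : sorted geq (sort geq (expts b)).
  by apply: sort_sorted => x y; exact: leq_total.
have lt : all (fun x => x < d)%N (sort geq (expts b)).
  rewrite all_sort; apply/allP => x /tnthP[i ->].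
  by rewrite tnth_mktuple ltn_ord.
have su : sumn (sort geq (expts b)) = mdeg b by rewrite (perm_sumn pe) sum_expts.
move: (sort _ _) pe sz so lt su => [|x [|y [|z []]]] //= pe _ so /andP[xd _] su.
exists (x, y, z); last by rewrite orbset_perm_eq.
by rewrite mem_Pset xd /= so su eqxx.
Qed.

Lemma mdeg_orbset b t j : t \in Pset (d - 1) j -> b \in orbset d t -> mdeg b = j.
Proof.
rewrite mem_Pset orbset_perm_eq => /and3P[_ _ /eqP tj] /perm_sumn.
by rewrite sum_expts tj => <-.
Qed.

Lemma orbset_nonempty t j : t \in Pset (d - 1) j -> exists b, b \in orbset d t.
Proof.
rewrite mem_Pset => /and3P[td so _].
have ti i : (trip t i < d)%N.
  move: td so; case: t => [[x y] z] /=; rewrite andbT /trip.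
  by case: (val i) => [|[|n]] /=; lia.
exists [ffun i => Ordinal (ti i)]; apply/orbsetP; exists 1%g => i.
by rewrite perm1 ffunE.
Qed.

(** * Orbit sums as a basis of the invariants *)

Lemma orbsumE t b : orbsum K d t b = (b \in orbset d t)%:R.
Proof.
rewrite sum_ffunE; case: (boolP (b \in _)) => bt.
  rewrite (bigD1 b) //= ffunE eqxx big1 ?addr0 // => a /andP[_ ab].
  by rewrite ffunE eq_sym (negPf ab).
rewrite big1 // => a at_; rewrite ffunE; case: eqP => // eab.
by rewrite eab at_ in bt.
Qed.

Lemma orbset_act (s : 'S_3) t b : ([ffun i => b (s i)] \in orbset d t) = (b \in orbset d t).
Proof.
apply/orbsetP/orbsetP => -[u bu].
  exists (u * s)%g => i; rewrite -bu ffunE permM //.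
by exists (u * s^-1)%g => i; rewrite -bu ffunE permM permKV.
Qed.

Lemma orbset_actP t b b' : b \in orbset d t -> b' \in orbset d t ->
  exists s : 'S_3, b' = [ffun i => b (s i)].
Proof.
move=> /orbsetP[s bs] /orbsetP[u bu]; exists (u^-1 * s)%g.
apply/ffunP => i; apply/val_inj; rewrite ffunE permM /= bs -bu.
by rewrite permKV.
Qed.

(** Distinct orbits are disjoint, so only the summand of [t] contributes at [b]. Both spanning and
    freeness rest on this. *)
Lemma sum_orbsumE (alpha : nat * nat * nat -> K) j b t :
  t \in Pset (d - 1) j -> b \in orbset d t ->
  (\sum_(t <- Pset (d - 1) j) alpha t *: orbsum K d t) b = alpha t.
Proof.
move=> tj bt; rewrite sum_ffunE (bigD1_seq t) ?Pset_uniq //= ffunE orbsumE bt.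
rewrite big_seq_cond big1 ?addr0 => [|t' /andP[tj' tt']]; first exact: mulr1.
rewrite ffunE orbsumE; case: (boolP (b \in orbset d t')) => bt'; last exact: mulr0.
by rewrite (orbset_inj b t' t j) ?eqxx in tt'.
Qed.

Lemma orbsum_invA t j : t \in Pset (d - 1) j -> orbsum K d t \in invA K d j.
Proof.
move=> tj; apply/invAP; split.
  apply/AcompP => b bj; rewrite orbsumE; case: (boolP (_ \in _)) => // bt.
  by rewrite (mdeg_orbset b t j) ?eqxx in bj.
by move=> s; apply/ffunP => b; rewrite ffunE !orbsumE orbset_act.
Qed.

Lemma invA_orbsumP j P :
  P \in invA K d j <-> exists alpha : nat * nat * nat -> K,
    P = \sum_(t <- Pset (d - 1) j) alpha t *: orbsum K d t.
Proof.
split=> [/invAP[/AcompP PA Ps]|[alpha ->]]; last first.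
  rewrite big_seq; apply: memv_suml => t tj; exact/memvZ/orbsum_invA.
(* The coefficient is the value of P at any monomial of the orbit: S_3 is transitive on it, so
   invariance makes the choice immaterial. The default 0 is never reached for [t] in [Pset]. *)
exists (fun t => if [pick b in orbset d t] is Some b then P b else 0).
apply/ffunP => b; have [t tb bt] := orbset_cover b.
have [bj|bj] := eqVneq (mdeg b) j.
  rewrite (sum_orbsumE _ j b t) -?bj //; case: pickP => [b' b't|/(_ b)]; last first.
    by rewrite bt.
  have [s ->] := orbset_actP t b b' bt b't.
  by rewrite -{1}(Ps s) ffunE.
rewrite PA // sum_ffunE big_seq big1 // => t' tj'; rewrite ffunE orbsumE.
case: (boolP (_ \in _)) => bt'; last exact: mulr0.
by rewrite (mdeg_orbset b t' j) ?eqxx in bj.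
Qed.

Lemma dim_invA j : \dim (invA K d j) = p3 (d - 1) j.
Proof.
pose X := [tuple of map (orbsum K d) (in_tuple (Pset (d - 1) j))].
have freeX : free X.
  apply/freeP => a a0 i.
  have i_lt : (i < size (Pset (d - 1) j))%N by [].
  pose t0 := (0%N, 0%N, 0%N).
  have ti := mem_nth t0 i_lt.
  (* Evaluated at a monomial of the [i]-th orbit, the relation reduces to [a i = 0]; [alpha]
     transports the indexed coefficients to triples. *)
  have [b bt] := orbset_nonempty _ _ ti.
  pose alpha t := if insub (index t (Pset (d - 1) j)) is Some i then a i else 0.
  have <- : alpha (nth t0 (Pset (d - 1) j) i) = a i.
    by rewrite /alpha index_uniq ?Pset_uniq // valK.
  rewrite -(sum_orbsumE alpha j b) // (big_nth t0) big_mkord.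
  transitivity ((\sum_i a i *: X`_i) b); last by rewrite a0 ffunE.
  congr (fun_of_fin _ b); apply: eq_bigr => k _.
  by rewrite /alpha index_uniq ?Pset_uniq // valK (nth_map t0).
have -> : invA K d j = <<X>>%VS.
  apply/eqP; rewrite eqEsubv; apply/andP; split; last first.
    by apply/span_subvP => _ /mapP[t tj ->]; exact: orbsum_invA.
  apply/subvP => P /invA_orbsumP[alpha ->].
  rewrite big_seq; apply: memv_suml => t tj.
  by apply/memvZ/memv_span/mapP; exists t.
by move: freeX; rewrite /free size_tuple => /eqP.
Qed.

End OrbitSums.

(** * Rank-nullity for E on the invariants of degree [j] *)

Theorem theorem3p1 (K : closedFieldType) (charK0 : [pchar K] =i pred0)
    (d j : nat) (hd : (3 <= d)%N) (hj : (j <= (3 * (d - 1))./2)%N) :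
  (forall P : Ad K d,
     (P \in Acomp K d j) /\ Emap P = 0 /\ (forall s : 'S_3, act s P = P)
     <->
     (exists alpha : nat * nat * nat -> K,
        P = \sum_(t <- Pset (d - 1) j) alpha t *: orbsum K d t) /\ Emap P = 0)
  /\
  (triv K d j)%:Z = (p3 (d - 1) j)%:Z - (p3 (d - 1) (j%:Z - 1))%:Z.
Proof.
have d0 : (0 < d)%N by apply: leq_trans hd.
split=> [P|].
  split=> [[PA [EP Ps]]|[/invA_orbsumP-/(_ d0)/invAP[PA Ps] EP]] //.
  by split=> //; apply/invA_orbsumP => //; apply/invAP.
have -> : triv K d j = \dim (invA K d j :&: lker (linfun (@Emap K d)))%VS.
  by rewrite /triv /invKerE /kerEcomp -capvA [X in (_ :&: X)%VS]capvC capvA.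
have := limg_ker_dim (linfun (@Emap K d)) (invA K d j).
rewrite (dim_invA K d d0 j) => <-; case: j hj => [|j] hj.
  (* In degree 0 the image of E is zero, matching the absence of triples of sum -1. *)
  have -> : (linfun (@Emap K d) @: invA K d 0)%VS = 0%VS.
    apply/eqP; rewrite -subv0; apply/subvP => _ /memv_imgP[P /invAP[PA _] ->].
    by rewrite lfunE /= Emap_Acomp0 // mem0v.
  have -> : p3 (d - 1) (0%:Z - 1) = 0%N.
    apply/eqP; rewrite /p3 size_filter -leqn0 leqNgt -has_count.
    by apply/hasPn => t _; apply/nandP; right.
  by rewrite dimv0 addn0 subr0.
(* Since [j.+1] is at most half of [3 * (d - 1)], the strict bound [2 * j < 3 * (d - 1)] holds. *)
rewrite Emap_invA_surj //; last by move: hj; lia.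
have -> : j.+1%:Z - 1 = j by lia.
by rewrite dim_invA // PoszD addrK.
Qed.
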